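(* $$\mathcal{D}_9=\{0,1,2,\ldots,102\}\cup\{104,105,108,110,112,116,117,120,125,128,144\}.$$ In particular, $a_9=103$.
   Context: For a positive integer $n$, $\mathcal{A}_n$ denotes the set of $n\times n$ matrices with all entries in $\{0,1\}$, and $\mathcal{D}_n=\{|\det A| : A\in\mathcal{A}_n\}$ (determinants computed over the integers). $a_n$ denotes the smallest positive integer not in $\mathcal{D}_n$. *)

(* Defs.v *)
From mathcomp Require Import all_boot all_order all_fingroup all_algebra.
From mathcomp Require Import boolp classical_sets.

Set Implicit Arguments.
Unset Strict Implicit.
Unset Printing Implicit Defensive.

Import Order.TTheory GRing.Theory Num.Theory.

Local Open Scope ring_scope.
Local Open Scope classical_set_scope.

Definition zero_one_mx (n : nat) : set 'M[int]_n :=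
  [set A : 'M[int]_n | forall i j, A i j = 0 \/ A i j = 1].

Arguments zero_one_mx n : clear implicits.

Definition det_spectrum (n : nat) : set nat :=
  [set `|\det A|%N | A in zero_one_mx n].

Lemma zero_one_det_le (n : nat) (A : 'M[int]_n) :
  zero_one_mx n A -> (`|\det A| <= n`!)%N.
Proof.
move=> A01; rewrite -lez_nat abszE /determinant.
apply: (le_trans (ler_norm_sum _ _ _)).
rewrite -card_Sn -sum1_card -natz natr_sum.
apply: ler_sum => s _; rewrite normrM normrX normrN1 expr1n mul1r.
rewrite normr_prod; apply: prodr_ile1 => i _.
by case: (A01 i (s i)) => ->; rewrite ?normr0 ?normr1.
Qed.

Lemma missing_det_exists (n : nat) :
  exists m : nat, (0 < m)%N && `[< ~ det_spectrum n m >].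
Proof.
exists n`!.+1; apply/andP; split=> //; apply/asboolP => -[A A01 eA].
by have := zero_one_det_le A01; rewrite eA ltnn.
Qed.

(* [ex_minn] returns the least witness, so this is the smallest positive
   integer outside [det_spectrum n]. *)
Definition least_missing_det (n : nat) : nat := ex_minn (missing_det_exists n).

(* Main.v *)
Require Import Defs.
From Stdlib Require Import ZArith FMapPositive.
From mathcomp Require Import all_boot all_order all_algebra.
From mathcomp Require Import ssrZ zify ring.
From mathcomp Require Import boolp classical_sets.

(** Border a 0/1 matrix A of order 9 by a row and a column of zeros and replace
    each entry a by 1 - 2a. This gives a sign matrix M of order 10 with
    |det M| = 2^9 |det A| (sign_border). Half its Gram matrix, H = M M^T / 2, is
    an integral positive definite matrix with diagonal entries 5, its sums
    H_ij + H_jk + H_ik are odd, and det H = 256 d^2 for d = |det A|. A large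
    determinant leaves few possibilities for H, so the matrices H are
    classified rather than the matrices A.

    Hadamard's inequality for the adjugate shows that a positive definite matrix
    of order k + 1 has a principal minor of order k that is at least
    det^(k / (k + 1)) (big_principal). Hence every H with det H >= 256 * 103^2
    arises by adding one row and column at a time, through matrices of order k
    with determinant at least (256 * 103^2)^(k / 10). Up to signed permutations,
    only 1, 3, 5, 16, 35, 81, 157, 275 and 433 matrices of orders 1 to 9 occur.
    They are found by a verified computation: extensions lists all the
    borderings above the threshold, cutting branches by Dodgson's identity, and
    catalog keeps one matrix of each class; next_levelP states that no class
    is lost.

    Among the borderings of order 10, those with determinant 256 d^2 for some
    d >= 103 that is not in the list form a single class, with d = 132. Such an
    H is not of the form M M^T / 2 (cleared_no_gram): since 3 divides det M,
    there would be a vector y, nonzero modulo 3, with y M = 0 modulo 3, hence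
    y H = 0 modulo 3 and y H y^T = 0 modulo 9, and a search through all
    y modulo 3 finds none.

    Conversely, the values in the list are attained by explicit matrices, whose
    determinants are evaluated by Laplace expansion (witnessesP). *)

Set Implicit Arguments.
Unset Strict Implicit.
Unset Printing Implicit Defensive.

Import Order.TTheory GRing.Theory Num.Theory.

Local Delimit Scope Z_scope with Z.
Local Open Scope ring_scope.

(** * Positive definite matrices and their minors *)

Section PosDef.
Variable R : realDomainType.

Definition qform n (A : 'M[R]_n) (x : 'rV_n) : R := (x *m A *m x^T) 0 0.

Definition posdef n (A : 'M[R]_n) : Prop :=
  A^T = A /\ forall x, x != 0 -> 0 < qform A x.

Definition border n (c : R) (r : 'rV[R]_n) (A : 'M[R]_n) : 'M[R]_(1 + n) :=
  block_mx c%:M r r^T A.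

(** Column operations with \adj A clear the lower left block without inverting A. *)
Lemma schur_det m n (K : 'M[R]_m) (V : 'M[R]_(m, n)) (A : 'M[R]_n) :
  A^T = A -> \det A != 0 ->
  \det A ^+ m * \det (block_mx K V V^T A) =
  \det (\det A *: K - V *m \adj A *m V^T) * \det A.
Proof.
move=> sA nz.
pose P := block_mx ((\det A)%:M : 'M_m) 0 (- (\adj A *m V^T)) (1%:M : 'M_n).
have EP : block_mx K V V^T A *m P =
          block_mx (\det A *: K - V *m \adj A *m V^T) V 0 A.
  rewrite mulmx_block !mulmx0 !mulmx1 !add0r !mulmxN !mulmxA mul_mx_scalar.
  by rewrite mul_mx_adj mul_mx_scalar mul_scalar_mx subrr.
have := congr1 determinant EP.
rewrite det_mulmx det_lblock det_scalar det1 mulr1 det_ublock => <-.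
by rewrite mulrC.
Qed.

Lemma qformZ n (A : 'M[R]_n) a x : qform A (a *: x) = a ^+ 2 * qform A x.
Proof.
by rewrite /qform linearZ /= -!scalemxAl -scalemxAr !mxE mulrA.
Qed.

Lemma qform_border n c (r : 'rV[R]_n) A (t : R) (w : 'rV[R]_n) :
  A^T = A ->
  qform (border c r A) (row_mx t%:M w) =
  t ^+ 2 * c + t * (r *m w^T) 0 0 *+ 2 + qform A w.
Proof.
move=> sA; rewrite /qform /border mul_row_block tr_row_mx mul_row_col tr_scalar_mx.
rewrite !mulmxDl !mul_scalar_mx -!scalemxAl !mul_mx_scalar.
have -> : w *m r^T = r *m w^T.
  by rewrite [LHS]mx11_scalar -[in LHS](trmxK (w *m _)) trmx_mul trmxK mxE -mx11_scalar.
move: (r *m w^T) (w *m A *m w^T) => b q; rewrite !mxE mulr1n.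
by rewrite expr2 mulr2n addrA mulrA -!addrA; congr (_ + (_ + _)); rewrite mulrC.
Qed.

Lemma posdef_border n c (r : 'rV[R]_n) A : posdef (border c r A) -> posdef A.
Proof.
case=> sH pH; have sA : A^T = A.
  by move: sH; rewrite /border tr_block_mx => /eq_block_mx [].
split=> // x x0.
have /pH : row_mx (0 : R)%:M x != 0.
  apply: contraNneq x0 => /(congr1 rsubmx); rewrite row_mxKr => ->.
  by rewrite linear0.
by rewrite qform_border // expr0n /= !mul0r mul0rn !add0r.
Qed.

Lemma borderE n (H : 'M[R]_n.+1) : H^T = H ->
  H = border (H 0 0) (ursubmx (H : 'M_(1 + n))) (drsubmx (H : 'M_(1 + n))).
Proof.
move=> sH; apply: etrans (esym (@submxK _ 1 n 1 n H)) _.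
have -> : ulsubmx (H : 'M_(1 + n)) = (H 0 0)%:M.
  by rewrite [LHS]mx11_scalar !mxE; congr (H _ _)%:M; apply: val_inj.
have -> : dlsubmx (H : 'M_(1 + n)) = (ursubmx (H : 'M_(1 + n)))^T.
  by rewrite trmx_ursub sH.
by [].
Qed.

Lemma border00 n (c : R) (r : 'rV_n) (A : 'M[R]_n) : border c r A ord0 ord0 = c.
Proof.
by rewrite !mxE; case: splitP => // j _; rewrite !mxE; case: splitP => // k _; rewrite !mxE !ord1.
Qed.

Lemma border0l n (c : R) (r : 'rV_n) (A : 'M[R]_n) j : border c r A ord0 (lift ord0 j) = r 0 j.
Proof.
rewrite !mxE; case: splitP => // k _; rewrite mxE.
by case: splitP => [[[|//] ?] //|l [jl]]; rewrite ord1 (val_inj jl).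
Qed.

Lemma borderl0 n (c : R) (r : 'rV_n) (A : 'M[R]_n) j : border c r A (lift ord0 j) ord0 = r 0 j.
Proof.
rewrite !mxE; case: splitP => [[[|//] ?] //|l [jl]]; rewrite mxE.
by case: splitP => // k _; rewrite mxE ord1 (val_inj jl).
Qed.

Lemma borderll n (c : R) (r : 'rV_n) (A : 'M[R]_n) i j :
  border c r A (lift ord0 i) (lift ord0 j) = A i j.
Proof. by rewrite -!rshift1; apply: block_mxEdr. Qed.

Lemma borderP n (c : R) (r : 'rV_n) (A : 'M[R]_n) (H : 'M[R]_n.+1) :
  H ord0 ord0 = c -> (forall j, H ord0 (lift ord0 j) = r 0 j) ->
  (forall j, H (lift ord0 j) ord0 = r 0 j) ->
  (forall i j, H (lift ord0 i) (lift ord0 j) = A i j) -> H = border c r A.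
Proof.
move=> h00 h0l hl0 hll; apply/matrixP => i j.
by case: (unliftP ord0 i) => [i' ->|->]; case: (unliftP ord0 j) => [j' ->|->];
  rewrite ?border00 ?border0l ?borderl0 ?borderll.
Qed.

Lemma adj_sym n (A : 'M[R]_n) : A^T = A -> (\adj A)^T = \adj A.
Proof. by move=> sA; rewrite trmx_adj sA. Qed.

Lemma qform_adj n (A : 'M[R]_n) y : A^T = A ->
  qform A (y *m \adj A) = \det A * qform (\adj A) y.
Proof.
move=> sA; rewrite /qform trmx_mul adj_sym // -(mulmxA y (\adj A) A) mul_adj_mx.
by rewrite mul_mx_scalar -scalemxAl mxE mulmxA.
Qed.

Lemma det_border_neq0 n c (r : 'rV[R]_n) A : A^T = A -> \det A != 0 ->
  \det (border c r A) = c * \det A - qform (\adj A) r.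
Proof.
move=> sA nz; have := schur_det (c%:M : 'M_1) r sA nz.
rewrite expr1 mulrC => /(mulIf nz) ->.
by rewrite det_mx11 /qform; move: (r *m _ *m _) => q; rewrite !mxE mulr1n mulrC.
Qed.

(** For H = border c r B, the form of H at (\det B, - r \adj B) is
    \det B * \det H, so positivity passes from B to H. *)
Lemma posdef_det_gt0 n (A : 'M[R]_n) : posdef A -> 0 < \det A.
Proof.
elim: n A => [|n IH] A; first by rewrite det_mx00.
move=> pA; have [sA _] := pA; move: pA; rewrite (borderE sA).
set c := A 0 0; set r := ursubmx _; set B := drsubmx _ => pA.
have pB := posdef_border pA; have dB := IH _ pB; have [sB _] := pB.
rewrite det_border_neq0 ?gt_eqF //.
have : 0 < qform (border c r B) (row_mx (\det B)%:M (- (r *m \adj B))).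
  apply: pA.2; apply/eqP => /(congr1 (@lsubmx R 1 1 n)); rewrite row_mxKl linear0.
  by move/matrixP/(_ 0 0); rewrite !mxE eqxx mulr1n => d0; rewrite d0 ltxx in dB.
rewrite qform_border // -(scaleN1r (r *m \adj B)) qformZ sqrrN expr1n mul1r qform_adj //.
rewrite linearZ /= -scalemxAr trmx_mul adj_sym // mulmxA mxE mulN1r -/(qform _ _).
move: (qform _ _) => q; have -> : \det B ^+ 2 * c + \det B * - q *+ 2 + \det B * q = \det B * (c * \det B - q).
  by ring.
by rewrite pmulr_rgt0.
Qed.

Lemma posdef_neq0 n (A : 'M[R]_n) : posdef A -> \det A != 0.
Proof. by move/posdef_det_gt0/gt_eqF => ->. Qed.

Lemma det_border n c (r : 'rV[R]_n) A : posdef A ->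
  \det (border c r A) = c * \det A - qform (\adj A) r.
Proof. by move=> pA; apply: det_border_neq0 (posdef_neq0 pA); case: pA. Qed.

(** As A * \adj A is scalar, the form of \adj A at y is, up to the factor
    \det A, the form of A at y \adj A. *)
Lemma posdef_adj n (A : 'M[R]_n) : posdef A -> posdef (\adj A).
Proof.
move=> pA; have [sA qA] := pA; have dA := posdef_det_gt0 pA.
split=> [|y y0]; first exact: adj_sym.
rewrite -(pmulr_rgt0 _ dA) -qform_adj //; apply: qA.
apply: contraNneq y0 => /(congr1 (mulmxr A)) /=.
rewrite mul0mx -mulmxA mul_adj_mx mul_mx_scalar => /matrixP E.
apply/eqP/matrixP => i j; have /eqP := E i j.
by rewrite !mxE mulf_eq0 gt_eqF //= => /eqP.
Qed.

Lemma posdef_qform_ge0 n (A : 'M[R]_n) x : posdef A -> 0 <= qform A x.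
Proof.
move=> [_ pA]; have [->|/pA/ltW //] := eqVneq x 0.
by rewrite /qform !mul0mx mxE.
Qed.

Lemma posdef_diag_gt0 n (A : 'M[R]_n) i : posdef A -> 0 < A i i.
Proof.
move=> [sA pA]; have -> : A i i = qform A (delta_mx 0 i).
  by rewrite /qform -rowE trmx_delta -colE !mxE.
apply: pA; apply/eqP => /matrixP/(_ 0 i); rewrite !mxE !eqxx /=.
by move/eqP; rewrite oner_eq0.
Qed.

(** A bordering multiplies the determinant by at most the new diagonal entry,
    because the form of the adjugate is nonnegative. *)
Lemma hadamard n (A : 'M[R]_n) : posdef A -> \det A <= \prod_i A i i.
Proof.
elim: n A => [|n IH] A; first by rewrite det_mx00 big_ord0.
move=> pA; have [sA _] := pA; move: pA; rewrite (borderE sA).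
set c := A 0 0; set r := ursubmx _; set B := drsubmx _ => pA.
have pB := posdef_border pA.
have c0 : 0 < c by rewrite -(border00 c r B) posdef_diag_gt0.
rewrite det_border // big_ord_recl border00.
rewrite (eq_bigr _ (fun i _ => borderll _ _ _ i i)).
rewrite lerBlDr; apply: (@le_trans _ _ (c * \prod_i B i i)).
  by rewrite ler_pM2l // IH.
by rewrite lerDl posdef_qform_ge0 //; apply: posdef_adj.
Qed.

Definition principal n (H : 'M[R]_n.+1) i := row' i (col' i H).

(** The diagonal of \adj H consists of the principal minors, and
    \det (\adj H) = \det H ^ n; Hadamard's inequality for \adj H bounds this by
    the product of the n + 1 minors. *)
Lemma big_principal n (H : 'M[R]_n.+1) : posdef H ->
  exists i, \det H ^+ n <= \det (principal H i) ^+ n.+1.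
Proof.
move=> pH; have dH := posdef_det_gt0 pH; have pJ := posdef_adj pH.
have dJ : \det (\adj H) = \det H ^+ n.
  apply: (@mulfI _ (\det H)); first by rewrite gt_eqF.
  by rewrite -exprS -det_mulmx mul_mx_adj det_scalar.
have adjE i : \adj H i i = \det (principal H i).
  by rewrite mxE /cofactor -signr_odd oddD addbb expr0 mul1r.
pose i0 := [arg max_(i > ord0) \adj H i i]%O.
exists i0; rewrite -dJ; apply: le_trans (hadamard pJ) _.
rewrite -adjE; have -> : \adj H i0 i0 ^+ n.+1 = \prod_(i < n.+1) \adj H i0 i0.
  by rewrite prodr_const card_ord.
apply: ler_prod => i _; rewrite ltW ?posdef_diag_gt0 //=.
rewrite /i0; case: arg_maxP => // j _; exact.
Qed.

Lemma det_block11 (a b c d : 'M[R]_1) :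
  \det (block_mx a b c d) = a 0 0 * d 0 0 - b 0 0 * c 0 0.
Proof.
rewrite (expand_det_row _ ord0) !big_ord_recl big_ord0 /cofactor !det_mx11 !mxE /=.
do !(case: splitP => [[[|//] ?]|[[|//] ?]] //= _; rewrite ?mxE ?ord1).
ring.
Qed.

(** Condensation: the Schur complement of A in the doubly bordered matrix has
    order 2. The subtracted term is a square, so the quotient of the
    determinants with and without the row v can only decrease when A is
    bordered; this is what prunes the enumeration below. *)
Lemma dodgson n c (v : 'rV[R]_n) (x : R) c' (r : 'rV[R]_n) A : posdef A ->
  \det A * \det (border c (row_mx x%:M v : 'rV_(1 + n)) (border c' r A)) =
  \det (border c' r A) * \det (border c v A)
  - (x * \det A - (v *m \adj A *m r^T) 0 0) ^+ 2.
Proof.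
move=> pA; have [sA _] := pA; have nz := posdef_neq0 pA.
pose K : 'M[R]_(1 + 1) := block_mx c%:M x%:M x%:M c'%:M.
pose V : 'M[R]_(1 + 1, n) := col_mx v r.
have -> : border c (row_mx x%:M v : 'rV_(1 + n)) (border c' r A) = block_mx K V V^T A.
  rewrite /border /K /V tr_row_mx tr_scalar_mx tr_col_mx.
  apply: etrans (@block_mxA R 1 1 n 1 1 n c%:M x%:M v x%:M c'%:M r v^T r^T A) _.
  exact: castmx_id.
have := schur_det K V sA nz.
rewrite expr2 -[RHS]mulrC -mulrA => /(mulfI nz) ->.
rewrite [\det (border c' r A)]det_border // [\det (border c v A)]det_border //.
have -> : V *m \adj A *m V^T = block_mx (v *m \adj A *m v^T) (v *m \adj A *m r^T)
    (r *m \adj A *m v^T) (r *m \adj A *m r^T).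
  by rewrite /V mul_col_mx tr_col_mx mul_col_row.
have -> : r *m \adj A *m v^T = v *m \adj A *m r^T.
  rewrite -[RHS]trmxK [RHS]mx11_scalar mxE -mx11_scalar.
  by rewrite !trmx_mul trmxK adj_sym // mulmxA.
rewrite /K scale_block_mx opp_block_mx add_block_mx /qform.
rewrite det_block11.
move: (r *m \adj A *m r^T) (v *m \adj A *m r^T) (v *m \adj A *m v^T) => a e b.
rewrite !mxE !mulr1n; ring.
Qed.

End PosDef.

(** * Equivalence under signed permutations *)

Section Reindex.
Variable R : realDomainType.

Definition signed_reindex k n (f : 'I_k -> 'I_n) (b : 'I_k -> bool) (H : 'M[R]_n) : 'M[R]_k :=
  \matrix_(i, j) ((-1) ^+ b i * (-1) ^+ b j * H (f i) (f j)).

(** Rows of a signed permutation matrix: signed_reindex is the congruence by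
    this matrix. *)
Definition signed_incl k n (f : 'I_k -> 'I_n) (b : 'I_k -> bool) : 'M[R]_(k, n) :=
  \matrix_(i, l) ((-1) ^+ b i *+ (l == f i)).

Lemma signed_inclM k n p f b (X : 'M[R]_(n, p)) (i : 'I_k) l :
  (signed_incl f b *m X) i l = (-1) ^+ b i * X (f i) l.
Proof.
rewrite mxE (bigD1 (f i)) //= big1 => [|j jf]; first by rewrite addr0 mxE eqxx.
by rewrite mxE (negbTE jf) mul0r.
Qed.

Lemma signed_reindexE k n f b (H : 'M[R]_n) :
  signed_reindex f b H = signed_incl f b *m H *m (signed_incl f b : 'M_(k, n))^T.
Proof.
apply/matrixP => i j; rewrite -mulmxA signed_inclM.
have -> : (H *m (signed_incl f b)^T) (f i) j = (signed_incl f b *m H^T) j (f i).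
  by rewrite -[H in LHS]trmxK -trmx_mul mxE.
by rewrite signed_inclM !mxE mulrA.
Qed.

Lemma signed_incl_unitary k n (f : 'I_k -> 'I_n) b : injective f ->
  signed_incl f b *m (signed_incl f b)^T = 1%:M.
Proof.
move=> injf; apply/matrixP => i j; rewrite signed_inclM !mxE (inj_eq injf).
by case: eqP => [->|]; rewrite ?mulr0 // -signr_addb addbb.
Qed.

Lemma posdef_signed_reindex k n (f : 'I_k -> 'I_n) b (H : 'M[R]_n) :
  injective f -> posdef H -> posdef (signed_reindex f b H).
Proof.
move=> injf [sH pH]; have U := signed_incl_unitary b injf.
split=> [|x x0]; first by rewrite signed_reindexE !trmx_mul trmxK sH mulmxA.
rewrite signed_reindexE /qform !mulmxA -!(mulmxA _ _ x^T) -trmx_mul; apply: pH.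
apply: contraNneq x0 => /(congr1 (mulmxr (signed_incl f b)^T)) /=.
by rewrite -mulmxA U mulmx1 mul0mx => ->.
Qed.

Lemma det_signed_reindex n (f : 'I_n -> 'I_n) b (H : 'M[R]_n) :
  injective f -> \det (signed_reindex f b H) = \det H.
Proof.
move=> injf; rewrite signed_reindexE !det_mulmx mulrAC -det_mulmx.
by rewrite signed_incl_unitary // det1 mul1r.
Qed.

Definition sgneq n (H K : 'M[R]_n) : Prop :=
  exists f b, injective f /\ K = signed_reindex f b H.

Lemma sgneq_refl n (H : 'M[R]_n) : sgneq H H.
Proof.
exists id, (fun=> false); split=> //.
by apply/matrixP => i j; rewrite mxE !mul1r.
Qed.

Lemma sgneq_trans n (H K L : 'M[R]_n) : sgneq H K -> sgneq K L -> sgneq H L.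
Proof.
move=> [f [b [injf ->]]] [f' [b' [injf' ->]]].
exists (f \o f'), (fun i => b' i (+) b (f' i)); split; first exact: inj_comp.
by apply/matrixP => i j; rewrite !mxE /= !signr_addb; ring.
Qed.

Lemma principalE n (H : 'M[R]_n.+1) i : principal H i = signed_reindex (lift i) (fun=> false) H.
Proof. by apply/matrixP => j k; rewrite !mxE !mul1r. Qed.

(** An equivalence of a principal submatrix extends to the whole matrix. The
    sign s of the added row is free, which lets the enumeration fix the sign of
    one entry. *)
Lemma sgneq_border n (H : 'M[R]_n.+1) i f b (s : bool) (G : 'M[R]_n) :
  H^T = H -> injective f -> G = signed_reindex f b (principal H i) ->
  sgneq H (border (H i i) (\row_j ((-1) ^+ s * (-1) ^+ b j * H i (lift i (f j)))) G).
Proof.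
move=> sH injf ->.
exists (fun x => oapp (fun j => lift i (f j)) i (unlift ord0 x)).
exists (fun x => oapp b s (unlift ord0 x)); split.
  move=> x y; case: unliftP => [x' ->|->]; case: unliftP => [y' ->|->] //=.
  - by move/lift_inj/injf => ->.
  - by move/eqP; rewrite eq_sym (negbTE (neq_lift _ _)).
  - by move/eqP; rewrite (negbTE (neq_lift _ _)).
have sHE x y : H y x = H x y by rewrite -[in LHS]sH mxE.
apply/esym/borderP => [|j|j|j k]; rewrite !mxE ?unlift_none ?liftK //=.
- by rewrite -signr_addb addbb mul1r.
- by rewrite sHE; ring.
Qed.

End Reindex.

(** * Matrices as lists of rows *)

(** Only the parts of the rows right of the diagonal are stored, the diagonal
    being constantly 5. The head is the row added last, so that the tail
    represents the matrix before that step. *)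
Fixpoint gram_entry (g : seq (seq Z)) (i j : nat) : Z :=
  if g is r :: g' then
    match i, j with
    | 0, 0 => 5%Z
    | 0, j'.+1 => nth 0%Z r j'
    | i'.+1, 0 => nth 0%Z r i'
    | i'.+1, j'.+1 => gram_entry g' i' j'
    end
  else 5%Z.

Definition gram_mx k (g : seq (seq Z)) : 'M[Z]_k := \matrix_(i, j) gram_entry g i j.
Definition row_of k (v : seq Z) : 'rV[Z]_k := \row_j nth 0%Z v j.

Lemma gram_mx_cons k r g : gram_mx k.+1 (r :: g) = border 5%Z (row_of k r) (gram_mx k g).
Proof. by apply: borderP => [|j|j|i j]; rewrite !mxE. Qed.

Lemma row_of_cons k x v : row_of k.+1 (x :: v) = row_mx (x%:M : 'M_1) (row_of k v).
Proof.
apply/rowP => j; rewrite !mxE.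
case: splitP => [[[|//] ?] /= ->|l /= ->]; rewrite mxE //.
Qed.

Fixpoint dot (u v : seq Z) : Z :=
  match u, v with
  | x :: u', y :: v' => (x * y + dot u' v')%Z
  | _, _ => 0%Z
  end.

Lemma dotE k u v : size u = k -> size v = k ->
  (row_of k u *m (row_of k v)^T) 0 0 = dot u v.
Proof.
elim: u k v => [|x u IH] [|k] [|y v] //=; first by rewrite mxE big_ord0.
move=> [su] [sv]; rewrite -(IH _ _ su sv) !mxE big_ord_recl !mxE /=.
by congr (_ + _); apply: eq_bigr => i _; rewrite !mxE.
Qed.

Fixpoint zip_with (f : Z -> Z -> Z) (u v : seq Z) : seq Z :=
  match u, v with
  | x :: u', y :: v' => f x y :: zip_with f u' v'
  | _, _ => [::]
  end.

Lemma size_zip_with f u v : size u = size v -> size (zip_with f u v) = size v.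
Proof. by elim: u v => [|x u IH] [|y v] //= [/IH ->]. Qed.

Lemma nth_zip_with f u v i : size u = size v -> (i < size v)%N ->
  nth 0%Z (zip_with f u v) i = f (nth 0%Z u i) (nth 0%Z v i).
Proof. by elim: u v i => [|x u IH] [|y v] [|i] //= [/IH]; apply. Qed.

(** A node of the enumeration is a list of cells (r, w, d, e), one for each
    row r. If A is the matrix of the tail, then d is its determinant, w is
    r \adj A, and e is the determinant after adding r. *)
Definition cell : Type := (seq Z * seq Z * Z * Z)%type.
Definition node_rows (c : seq cell) : seq (seq Z) := [seq x.1.1.1 | x <- c].
Definition node_det (c : seq cell) : Z := if c is (_, _, _, e) :: _ then e else 1%Z.

Fixpoint node_ok (c : seq cell) : Prop :=
  if c is (r, w, d, e) :: c' then
    [/\ node_ok c', size r = size c' /\ size w = size c', d = node_det c',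
        row_of (size c') w = row_of (size c') r *m \adj (gram_mx (size c') (node_rows c'))
      & e = \det (gram_mx (size c) (node_rows c))]
  else True.

Lemma node_detE c : node_ok c -> node_det c = \det (gram_mx (size c) (node_rows c)).
Proof. by case: c => [|[[[r w] d] e] c] /=; [rewrite det_mx00 | case]. Qed.

Definition node_pos c := posdef (gram_mx (size c) (node_rows c)).

Lemma node_pos_tail x c : node_pos (x :: c) -> node_pos c.
Proof. by rewrite /node_pos /= gram_mx_cons => /posdef_border. Qed.

(** The product v \adj A. If m :: b is the product of x :: v and the adjugate of
    the bordered matrix, then multiplying (m :: b) H = e (x :: v) by \adj A gives
    d b = e (v \adj A) - m w, whence the recursion and its exact division. *)
Fixpoint mul_adj (c : seq cell) (v : seq Z) : seq Z :=
  match c, v with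
  | (r, w, d, e) :: c', x :: v' =>
    let y := mul_adj c' v' in
    let m := (x * d - dot v' w)%Z in
    m :: zip_with (fun yi wi => (e * yi - m * wi) / d)%Z y w
  | _, _ => [::]
  end.

Lemma mul_adjE c v : node_ok c -> node_pos c -> size v = size c ->
  size (mul_adj c v) = size c /\
  row_of (size c) (mul_adj c v) = row_of (size c) v *m \adj (gram_mx (size c) (node_rows c)).
Proof.
elim: c v => [|[[[r w] d] e] c IH] [|x v] //=.
  by move=> *; split=> //; apply/rowP => -[].
move=> [okc [sr sw] dE wE eE] pc [sv]; have pc' := node_pos_tail pc.
have [ss sE] := IH v okc pc' sv.
have zs : size (zip_with (fun yi wi => ((e * yi - (x * d - dot v w) * wi) / d)%Z)
  (mul_adj c v) w) = size c by rewrite size_zip_with ?sw.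
split; first by rewrite /= zs.
rewrite !row_of_cons gram_mx_cons.
rewrite node_detE // in dE; rewrite gram_mx_cons in eE.
set A := gram_mx _ (node_rows c) in sE dE wE eE pc' *.
have [sA _] := pc'; have d0 : d != 0 by rewrite dE posdef_neq0.
rewrite /node_pos /= gram_mx_cons -/A in pc.
set R := row_of _ r in wE eE pc *; set V := row_of _ v in sE *.
set W := row_of _ w in wE *; set Y := row_of _ (mul_adj c v) in sE.
set B := border 5%Z R A in eE pc *.
pose P : 'rV[Z]_(1 + size c) := row_mx x%:M V *m \adj B.
rewrite -[RHS]/P -(hsubmxK P); set a := lsubmx P; set b := rsubmx P.
have E : row_mx a b *m B = e *: row_mx x%:M V.
  by rewrite hsubmxK -mulmxA mul_adj_mx mul_mx_scalar eE.
clearbody a b; rewrite [a]mx11_scalar in E *; move: (a 0 0) E => {}a.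
rewrite /border mul_row_block scale_row_mx => /eq_row_mx [E1 E2].
have dot_m : dot v w = (Y *m R^T) 0 0.
  rewrite -(@dotE (size c)) // -/W wE sE trmx_mul adj_sym // mulmxA.
  by rewrite -/V.
have E3 : d *: b = e *: Y - a *: W.
  have := congr1 (mulmxr (\adj A)) E2; rewrite /= mulmxDl -(mulmxA b) mul_mx_adj -dE.
  rewrite mul_mx_scalar -scalemxAl -sE mul_scalar_mx -scalemxAl -wE => <-.
  by rewrite addrAC subrr add0r.
(* The first column of E, multiplied by d, is a * e = (x * d - dot v w) * e. *)
have aE : a = (x * d - dot v w)%Z.
  have e0 : e != 0 by rewrite eE posdef_neq0.
  have eq_e : e = (5 * d - (W *m R^T) 0 0)%R.
    by rewrite eE det_border // dE /qform wE.
  have E5 : d * (b *m R^T) 0 0 = e * dot v w - a * (W *m R^T) 0 0.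
    have := congr1 (fun M : 'rV_(size c) => (M *m R^T) 0 0) E3.
    by rewrite mulmxBl -!scalemxAl dot_m !mxE.
  have E6 : a * 5 + (b *m R^T) 0 0 = e * x.
    have := congr1 (fun M : 'M_1 => M 0 0) E1.
    by rewrite -scalar_mxM scale_scalar_mx !mxE !mulr1n.
  apply: (mulfI e0); move: E5 E6 eq_e; clear.
  move: (_ 0 0) ((W *m R^T) 0 0) => p q E5 E6 eq_e.
  have := congr1 (fun z => z * d) E6; have := congr1 (fun z => a * z) eq_e.
  lia.
rewrite -aE; congr (@row_mx _ 1 1 (size c) _ _).
apply/rowP => j; rewrite mxE nth_zip_with ?sw ?ltn_ord //.
have /rowP/(_ j) := E3; rewrite !mxE => E4.
have -> : (e * nth 0 (mul_adj c v) j - a * nth 0 w j)%Z = b 0 j * d.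
  by rewrite [RHS]mulrC E4.
by apply: Z.div_mul; apply/eqP.
Qed.

(** * Enumeration of the borderings of a matrix *)

Lemma oddZD (x y : Z) : Z.odd (x + y)%R = Z.odd x (+) Z.odd y.
Proof. by rewrite -[(x + y)%R]/(Z.add x y) Z.odd_add; case: (Z.odd x). Qed.

Lemma oddZN (x : Z) : Z.odd (- x)%R = Z.odd x.
Proof. exact: Z.odd_opp. Qed.

(** This determines the parities of all entries from those in one row. *)
Definition odd_triangles k (H : 'M[Z]_k) : Prop :=
  forall i j l, Z.odd (H i j + H j l + H i l)%R.

Lemma odd_triangles_reindex k n (f : 'I_k -> 'I_n) b (H : 'M[Z]_n) :
  odd_triangles H -> odd_triangles (signed_reindex f b H).
Proof.
have sgnE (s t : bool) (x : Z) : Z.odd ((-1) ^+ s * (-1) ^+ t * x)%R = Z.odd x.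
  by case: s; case: t; rewrite ?expr1 ?expr0 ?mulN1r ?mulr1 ?mul1r ?mulNr ?mul1r ?opprK ?oddZN.
by move=> oH i j l; rewrite !mxE !oddZD !sgnE -!oddZD.
Qed.

(** Positivity of the minors of order 2 bounds an entry by 4 in absolute value,
    and its parity follows from the triangle formed with the oldest row. The
    first entry is taken nonnegative, at the cost of a sign change of the new
    row. *)
Definition next_entries (r v : seq Z) : seq Z :=
  if v is [::] then [:: 0; 1; 2; 3; 4]%Z else
  if Z.odd (last 0 v + last 0 r)%Z then [:: 0; 2; -2; 4; -4]%Z
  else [:: 1; -1; 3; -3]%Z.

(** Rows v paired with the determinant E of the matrix bordered by v, where dk
    is the determinant of the whole node and t the least determinant wanted. A
    partial row is kept as long as E / e is at least t / dk, up to rounding, for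
    e the determinant of the part of the node that it borders. *)
Fixpoint extensions (t dk : Z) (c : seq cell) : seq (seq Z * Z) :=
  if c is (r, w, d, e) :: c' then
    let b := (t * e * d / dk)%Z in
    flatten [seq
       let z0 := (e * p.2)%Z in
       let m0 := dot p.1 w in
       pmap (fun x =>
         let m := (x * d - m0)%Z in
         let z := (z0 - m * m)%Z in
         if (b <=? z)%Z then Some (x :: p.1, (z / d)%Z) else None) (next_entries r p.1)
      | p <- extensions t dk c']
  else [:: ([::], 5%Z)].

Lemma dodgson_list r w d e c x v :
  node_ok ((r, w, d, e) :: c) -> node_pos ((r, w, d, e) :: c) -> size v = size c ->
  d * \det (gram_mx (size c).+2 ((x :: v) :: r :: node_rows c)) =
  e * \det (gram_mx (size c).+1 (v :: node_rows c)) - (x * d - dot v w) * (x * d - dot v w).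
Proof.
move=> /= [okc [sr sw] dE wE eE] pc sv.
have pc' := node_pos_tail pc; have [sA _] := pc'.
rewrite node_detE // in dE.
rewrite !gram_mx_cons row_of_cons dE dodgson // -dE -!gram_mx_cons -eE expr2.
have -> // : (row_of (size c) v *m \adj (gram_mx (size c) (node_rows c)) *m (row_of (size c) r)^T) 0 0 = dot v w.
by rewrite -(@dotE (size c)) // wE trmx_mul adj_sym // mulmxA.
Qed.

Lemma extensions_sound t dk c p : node_ok c -> node_pos c -> p \in extensions t dk c ->
  size p.1 = size c /\ p.2 = \det (gram_mx (size c).+1 (p.1 :: node_rows c)).
Proof.
elim: c p => [|[[[r w] d] e] c IH] p okc pc /=.
  by rewrite inE => /eqP -> /=; rewrite det_mx11 mxE.
case/flatten_mapP => [[v E]] /= /IH [].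
- by case: okc.
- exact: node_pos_tail pc.
move=> /= sv EE; rewrite mem_pmap => /mapP [x _].
case: ifP => // _ [->] /=; rewrite sv; split=> //.
have D := dodgson_list x okc pc sv.
rewrite [X in (X / _)%Z](_ : _ = \det (gram_mx (size c).+2 ((x :: v) :: r :: node_rows c)) * d).
  apply: Z.div_mul; apply/eqP; case: okc => okc _ -> _ _; rewrite node_detE //.
  exact/posdef_neq0/node_pos_tail/pc.
by rewrite mulrC D EE.
Qed.

Lemma small_entry (x : Z) : 0 < 5%Z * 5%Z - x * x ->
  x \in if Z.odd x then [:: 1; -1; 3; -3]%Z else [:: 0; 2; -2; 4; -4]%Z.
Proof.
move=> x25; have [x1 x2] : (-5 < x /\ x < 5)%Z by nia.
have : (x = 0 \/ x = 1 \/ x = 2 \/ x = 3 \/ x = 4 \/ x = -1 \/ x = -2 \/ x = -3 \/ x = -4)%Z.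
  by lia.
by do 8?[case=> [-> //|]] => ->.
Qed.

(** By dodgson the quotient of the bordered and the plain determinant decreases
    along the node, so a row that passes the last test has passed all the
    others. *)
Lemma extensions_complete (t dk : Z) c (v : seq Z) : node_ok c -> node_pos c -> size v = size c ->
  0 <= last 0 v -> 0 <= t -> 0 < dk ->
  posdef (gram_mx (size c).+1 (v :: node_rows c)) -> odd_triangles (gram_mx (size c).+1 (v :: node_rows c)) ->
  t * node_det c <= dk * \det (gram_mx (size c).+1 (v :: node_rows c)) ->
  (v, \det (gram_mx (size c).+1 (v :: node_rows c))) \in extensions t dk c.
Proof.
elim: c v => [|[[[r w] d] e] c IH] [|x v] //.
  by move=> *; rewrite inE det_mx11 mxE.
move=> okc pc [sv] l0 t0 dk0 pH oH bnd.
have pc' := node_pos_tail pc; have [okc' [sr sw] dE wE eE] := okc.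
have d0 : 0 < d by rewrite dE node_detE // posdef_det_gt0.
have e0 : 0 < e by rewrite eE posdef_det_gt0.
have D := dodgson_list x okc pc sv.
set H := gram_mx _ _ in pH oH bnd *.
have HE : H = gram_mx (size c).+2 ((x :: v) :: r :: node_rows c) by [].
rewrite -HE in D.
have H'E : gram_mx (size c).+1 (v :: node_rows c) =
    signed_reindex (lift (lift ord0 ord0)) (fun=> false) H.
  by apply/matrixP => i j; rewrite !mxE !mul1r; case: i j => [[|i] li] [[|j] lj].
have inj_l := @lift_inj _ (lift ord0 ord0 : 'I_(size c).+2).
have vin : (v, \det (gram_mx (size c).+1 (v :: node_rows c))) \in extensions t dk c.
  apply: IH => //.
  - by case: (v) l0.
  - by rewrite H'E; apply: posdef_signed_reindex.
  - by rewrite H'E; apply: odd_triangles_reindex.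
  - rewrite -dE -(ler_pM2l e0); move: bnd D => /=.
    move: (\det H) (\det (gram_mx (size c).+1 (v :: node_rows c))) (x * d - dot v w) dk0 d0 => p q m dk0 d0 bnd D.
    have -> : e * (dk * q) = d * (dk * p) + dk * (m * m).
      have eq1 : e * q = d * p + m * m by rewrite D subrK.
      by rewrite mulrCA eq1 mulrDr mulrCA.
    rewrite mulrCA; apply: (@le_trans _ _ (d * (dk * p))).
      by rewrite mulrA [t * e * d]mulrC ler_pM2l.
    by rewrite lerDl; apply: mulr_ge0; [apply: ltW | rewrite -expr2 sqr_ge0].
apply/flatten_mapP; eexists; first exact: vin.
rewrite mem_pmap; apply/mapP; exists x => /=.
  have le2 : (2 <= (size c).+2)%N by [].
  have p2 : posdef (gram_mx 2 ((x :: v) :: r :: node_rows c)).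
    have -> : gram_mx 2 ((x :: v) :: r :: node_rows c) =
        signed_reindex (widen_ord le2) (fun=> false) H.
      by apply/matrixP => i j; rewrite !mxE !mul1r.
    by apply: posdef_signed_reindex => // i j /(congr1 val) /= /val_inj.
  have := posdef_det_gt0 p2.
  rewrite gram_mx_cons det_block11 !mxE /= mulr1n => x25.
  have xr := small_entry x25.
  (* The triangle formed by the new, the current and the oldest row. *)
  have odd3 : (0 < size c)%N -> Z.odd (x + last 0%Z r + last 0%Z v)%R.
    move=> c_gt0; have := oH ord0 (lift ord0 ord0) ord_max.
    have last_ord (z : seq Z) : size z = size c -> nth 0%Z z (size c).-1 = last 0%Z z.
      by move=> <-; rewrite nth_last.
    by rewrite !mxE /= -{1 2}(prednK c_gt0) /= !last_ord.
  case: (v) sv l0 odd3 => [|y v'] sv l0 odd3.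
    rewrite /= in l0; rewrite !inE; case: ifP xr; rewrite !inE => _.
      by case/or4P => /eqP E; rewrite E in l0 *.
    by case/orP => [|/or4P[]] => /eqP E; rewrite E in l0 *.
  have := odd3; rewrite -sv => /(_ isT).
  rewrite -addrA oddZD /= addrC -[(_ + _)%R]/(Z.add _ _).
  by case: (Z.odd x) xr; case: (Z.odd _).
set z := (X in (_ <=? X)%Z); have -> : z = d * \det H by rewrite D.
case: ifP => [_|/negP []].
  congr (Some (_, _)); rewrite [X in (X / d)%Z](_ : _ = \det H * d).
    by apply/esym/Z.div_mul/eqP; rewrite gt_eqF.
  by rewrite mulrC D.
apply/Z.leb_le; move: bnd d0 dk0 => /= bnd d0 dk0.
move: (\det H) bnd => p bnd; apply: Z.div_le_upper_bound; first by lia.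
have : t * e * d <= dk * p * d by rewrite ler_pM2r.
lia.
Qed.

(** * Search for equivalent matrices *)

Fixpoint cons_column (r : seq Z) (F : seq (seq Z)) : seq (seq Z) :=
  if F is a :: F' then (head 0%Z r :: a) :: cons_column (behead r) F' else [::].

Fixpoint gram_rows (g : seq (seq Z)) : seq (seq Z) :=
  if g is r :: g' then (5%Z :: r) :: cons_column r (gram_rows g') else [::].

Lemma size_cons_column r F : size (cons_column r F) = size F.
Proof. by elim: F r => //= a F IH r; rewrite IH. Qed.

Lemma size_gram_rows g : size (gram_rows g) = size g.
Proof. by elim: g => //= r g IH; rewrite size_cons_column IH. Qed.

Lemma nth_cons_column r F i : (i < size F)%N ->
  nth [::] (cons_column r F) i = nth 0%Z r i :: nth [::] F i.
Proof.
elim: F r i => // a F IH r [|i] /=; first by rewrite nth0.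
by move=> /IH ->; rewrite nth_behead.
Qed.

Lemma nth_gram_rows g i j : (i < size g)%N -> nth 0%Z (nth [::] (gram_rows g) i) j = gram_entry g i j.
Proof.
elim: g i j => // r g IH [|i] [|j] //=; rewrite ltnS => li.
- by rewrite nth_cons_column ?size_gram_rows.
- by rewrite nth_cons_column ?size_gram_rows //= IH.
Qed.

Lemma gram_entryC g i j : gram_entry g i j = gram_entry g j i.
Proof. by elim: g i j => //= r g IH [|i] [|j] //. Qed.

Lemma gram_entry_diag g i : gram_entry g i i = 5%Z.
Proof. by elim: g i => //= r g IH [|i] //. Qed.

(** The lengths must agree, so success also validates the size of r. *)
Fixpoint row_agrees (s : bool) (r F : seq Z) (q : seq (nat * bool)) : bool :=
  match r, q with
  | [::], [::] => true
  | x :: r', (j, s') :: q' =>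
    let y := nth 0%Z F j in
    (x =? (if s (+) s' then - y else y))%Z && row_agrees s r' F q'
  | _, _ => false
  end.

Lemma row_agreesE s r F q : row_agrees s r F q -> size r = size q /\
  forall b, (b < size q)%N -> nth 0%Z r b =
    (-1) ^+ s * (-1) ^+ (nth (0%N, false) q b).2 * nth 0%Z F (nth (0%N, false) q b).1.
Proof.
elim: r q => [|x r IH] [|[j s'] q] //= /andP[/Z.eqb_eq -> /IH [-> IHn]].
split=> // -[_|b /IHn //] /=.
by rewrite -signr_addb; case: (s (+) s'); rewrite ?mulN1r ?mul1r.
Qed.

(** Position, label and full row. *)
Definition vertex : Type := (nat * (Z * seq Z))%type.

Fixpoint has_pick (f : vertex -> seq vertex -> bool) (pre l : seq vertex) : bool :=
  if l is x :: l' then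
    if f x (catrev pre l') then true else has_pick f (x :: pre) l'
  else false.

Lemma has_pickP f pre l : has_pick f pre l ->
  exists x rem, perm_eq (x :: rem) (pre ++ l) /\ f x rem.
Proof.
elim: l pre => //= x l IH pre; case: ifP => [fx _|_ /IH [y [rem [p fy]]]].
  exists x, (catrev pre l); split=> //.
  by apply/permP => a; rewrite catrevE /= !count_cat /= count_rev addnCA.
exists y, rem; split=> //; apply: (perm_trans p).
by apply/permP => a; rewrite /= !count_cat /= addnCA.
Qed.

(** Backtracking search for a signed bijection from the rows rs, the oldest
    first, to the vertices in rem; q holds the vertices chosen so far. The labels
    only steer the search. *)
Fixpoint embeds_into (rs : seq (Z * seq Z)) (q : seq (nat * bool)) (rem : seq vertex) : bool :=
  if rs is (t, r) :: rs' then
    has_pick (fun x rem' =>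
      let: (i, (ti, F)) := x in
      if (t =? ti)%Z then
        if (if row_agrees false r F q then embeds_into rs' ((i, false) :: q) rem' else false)
        then true
        else if row_agrees true r F q then embeds_into rs' ((i, true) :: q) rem' else false
      else false) [::] rem
  else true.

Fixpoint embeds (F : seq (seq Z)) (h : seq (seq Z)) (q : seq (nat * bool)) : bool :=
  match h, q with
  | [::], [::] => true
  | r :: h', (i, s) :: q' => row_agrees s r (nth [::] F i) q' && embeds F h' q'
  | _, _ => false
  end.

Lemma embeds_intoP F rs q rem h :
  (forall x, x \in rem -> x.2.2 = nth [::] F x.1) ->
  uniq (map fst q ++ map fst rem) -> embeds F h q -> embeds_into rs q rem ->
  exists q', [/\ embeds F (catrev (map snd rs) h) q', uniq (map fst q') &
    {subset map fst q' <= map fst q ++ map fst rem}].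
Proof.
elim: rs q rem h => [|[t r] rs IH] q rem h remF un eh.
  move=> _; exists q; split=> //; first by move: un; rewrite cat_uniq => /andP[].
  by move=> i; rewrite mem_cat => ->.
move=> /= /has_pickP [[i [ti G]] [rem' [p]]] /=; rewrite cat0s in p.
case: ifP => // _ fx.
have GE : G = nth [::] F i by apply: (remF (i, (ti, G))); rewrite -(perm_mem p) mem_head.
have [s [ag mt]] : exists s, row_agrees s r G q /\ embeds_into rs ((i, s) :: q) rem'.
  move: fx; case: ifP => [|_]; case: ifP => // a m; [by exists false | by exists true].
have p' : perm_eq ((i :: map fst q) ++ map fst rem') (map fst q ++ map fst rem).
  rewrite -cat1s -catA perm_catCA perm_cat2l.
  by have := perm_map fst p.
have [|||q' [e' u' sub]] := IH ((i, s) :: q) rem' (r :: h) _ _ _ mt.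
- by move=> x xr; apply: remF; rewrite -(perm_mem p) inE xr orbT.
- by rewrite (perm_uniq p').
- by rewrite /= -GE ag.
by exists q'; split=> // j /sub; rewrite (perm_mem p').
Qed.

Lemma embedsE F h q : embeds F h q -> size h = size q /\
  forall a b, (a < b < size q)%N ->
   gram_entry h a b = (-1) ^+ (nth (0%N, false) q a).2 * (-1) ^+ (nth (0%N, false) q b).2 *
     nth 0%Z (nth [::] F (nth (0%N, false) q a).1) (nth (0%N, false) q b).1.
Proof.
elim: h q => [|r h IH] [|[i s] q] //=; first by split=> // a b; rewrite ltn0 andbF.
move=> /andP[/row_agreesE [sr ag] /IH [-> IHe]]; split=> // -[|a] [|b] //=.
  by rewrite ltnS => /ag.
by rewrite !ltnS => /IHe.
Qed.

(** The diagonal of the cube of the matrix is insensitive to sign changes and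
    moves along with permutations, so it labels the vertices. *)
Definition closed_walks (F : seq (seq Z)) : seq Z :=
  [seq dot r [seq dot r s | s <- F] | r <- F].

Definition vertices (F : seq (seq Z)) : seq vertex := zip (iota 0 (size F)) (zip (closed_walks F) F).

Lemma embeds_into_sgneq g h rs k : size g = k -> size h = k -> map snd rs = rev h ->
  embeds_into rs [::] (vertices (gram_rows g)) -> sgneq (gram_mx k g) (gram_mx k h).
Proof.
move=> sg sh rsh.
have fstV : map fst (vertices (gram_rows g)) = iota 0 k.
  rewrite -/unzip1 unzip1_zip ?size_gram_rows ?sg //.
  by rewrite size_zip size_map minnn size_gram_rows sg size_iota.
case/(@embeds_intoP (gram_rows g) _ _ _ [::]) => //.
- move=> [i [t G]]; rewrite /vertices => /(nthP (0%N, (0%Z, [::]))) [a].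
  rewrite size_zip => la; rewrite nth_zip; last first.
    by rewrite size_iota size_zip size_map minnn.
  rewrite nth_zip ?size_map //= => -[<- _ <-]; rewrite nth_iota ?add0n //.
  by apply: leq_trans la _; rewrite size_iota geq_minl.
- by rewrite fstV iota_uniq.
move=> q [eq uq]; rewrite fstV /= => sub.
have {}eq : embeds (gram_rows g) h q by move: eq; rewrite rsh catrevE revK cats0.
have [sq ent] := embedsE eq; rewrite sh in sq.
pose f (a : 'I_k) := insubd a (nth (0%N, false) q a).1.
have fE (a : 'I_k) : f a = (nth (0%N, false) q a).1 :> nat.
  rewrite val_insubd; have -> // : ((nth (0%N, false) q a).1 < k)%N.
  have /sub : (nth (0%N, false) q a).1 \in map fst q.
    by apply: map_f; rewrite mem_nth -?sq.
  by rewrite mem_iota.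
exists f, (fun a => (nth (0%N, false) q a).2); split.
  move=> a b /(congr1 val) /=; rewrite !fE => E; apply/val_inj/eqP => /=.
  have := nth_uniq 0%N _ _ uq; rewrite size_map -sq => <- //.
  by rewrite !(nth_map (0%N, false)) -?sq // E.
have main (a b : 'I_k) : (a < b)%N -> gram_entry h a b =
    (-1) ^+ (nth (0%N, false) q a).2 * (-1) ^+ (nth (0%N, false) q b).2 * gram_entry g (f a) (f b).
  move=> ab; rewrite ent ?ab -?sq ?ltn_ord // -!fE nth_gram_rows // sg; exact: ltn_ord.
apply/matrixP => a b; rewrite !mxE.
case: (ltngtP a b) => [/main //|/main|/val_inj ->].
  by rewrite gram_entryC => ->; rewrite [gram_entry g _ _]gram_entryC mulrAC mulrC mulrA mulrAC.
by rewrite -signr_addb addbb mul1r !gram_entry_diag.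
Qed.

Definition rep : Type := (seq (Z * seq Z) * seq cell)%type.
Definition ext : Type := (seq cell * (seq Z * Z))%type.
(** The map, indexed by determinants, serves to find an equivalent node among
    those recorded; the list collects the result. *)
Definition catalogue : Type := (PositiveMap.t (seq rep) * seq (seq cell))%type.

Definition grow (x : ext) : seq cell :=
  (x.2.1, mul_adj x.1 x.2.1, node_det x.1, x.2.2) :: x.1.

Definition record_ext (acc : catalogue) (x : ext) : catalogue :=
  let g := x.2.1 :: node_rows x.1 in
  let F := gram_rows g in
  let V := vertices F in
  let k := Z.to_pos x.2.2 in
  let l := if PositiveMap.find k acc.1 is Some l then l else [::] in
  if has (fun y : rep => embeds_into y.1 [::] V) l then acc
  else let n := grow x in
    (PositiveMap.add k ((rev (zip (closed_walks F) g), n) :: l) acc.1, n :: acc.2).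

Definition indexed (acc : catalogue) : Prop := forall k l y,
  PositiveMap.find k acc.1 = Some l -> y \in l ->
  y.2 \in acc.2 /\ map snd y.1 = rev (node_rows y.2).

Lemma snd_zip_closed_walks g : map snd (rev (zip (closed_walks (gram_rows g)) g)) = rev g.
Proof. by rewrite map_rev -/unzip2 unzip2_zip ?size_map ?size_gram_rows. Qed.

Lemma record_indexed acc x : indexed acc -> indexed (record_ext acc x).
Proof.
move=> ia; rewrite /record_ext; cbv zeta; set pat := rev (zip _ _).
have patE : map snd pat = rev (node_rows (grow x)) by apply: snd_zip_closed_walks.
clearbody pat; case: ifP => // _ k l y /=.
case: (Pos.eq_dec k (Z.to_pos x.2.2)) => [->|ne].
  rewrite PositiveMap.gss => -[<-]; rewrite inE => /orP[/eqP ->|].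
    by rewrite mem_head.
  case E: PositiveMap.find => [l'|] // /(ia _ _ _ E) [yin ->].
  by rewrite inE yin orbT.
rewrite PositiveMap.gso // => /ia H /H [yin ->].
by rewrite inE yin orbT.
Qed.

Lemma record_sub acc x : {subset acc.2 <= (record_ext acc x).2}.
Proof. by rewrite /record_ext; case: ifP => _ y //= yin; rewrite inE yin orbT. Qed.

Lemma record_mem acc x c : c \in (record_ext acc x).2 -> c \in acc.2 \/ c = grow x.
Proof.
rewrite /record_ext; case: ifP => _ /=; first by left.
by rewrite inE => /orP[/eqP ->|]; [right | left].
Qed.

Lemma record_sgneq acc x k : indexed acc -> 
  (forall c, c \in acc.2 -> size c = k) -> size x.1 = k.-1 -> (0 < k)%N ->
  exists2 c, c \in (record_ext acc x).2 & sgneq (gram_mx k (node_rows (grow x))) (gram_mx k (node_rows c)).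
Proof.
move=> ia sz sx k0; rewrite /record_ext; case: ifP => [/hasP [y]|_ /=]; last first.
  by exists (grow x); [rewrite mem_head | apply: sgneq_refl].
case E: PositiveMap.find => [l|] // /(ia _ _ _ E) [yin yr] mt.
exists y.2 => //; apply: embeds_into_sgneq yr mt.
- by rewrite /= size_map sx prednK.
- by rewrite size_map sz.
Qed.

Lemma indexed_foldl X : indexed (foldl record_ext (PositiveMap.empty _, [::]) X).
Proof.
elim/last_ind: X => [|X x IH]; last by rewrite foldl_rcons; apply: record_indexed.
by move=> i l y; rewrite PositiveMap.gempty.
Qed.

Definition catalog (X : seq ext) : seq (seq cell) :=
  (foldl record_ext (PositiveMap.empty _, [::]) X).2.

Lemma catalog_mem X c : c \in catalog X -> exists2 x, x \in X & c = grow x.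
Proof.
rewrite /catalog; elim/last_ind: X => // X x IH; rewrite foldl_rcons.
case/record_mem => [/IH [y yX ->]|->]; [exists y | exists x] => //.
- by rewrite mem_rcons inE yX orbT.
- by rewrite mem_rcons mem_head.
Qed.

Lemma catalog_sgneq X k : (forall x, x \in X -> size x.1 = k) ->
  forall x, x \in X -> exists2 c, c \in catalog X &
    sgneq (gram_mx k.+1 (node_rows (grow x))) (gram_mx k.+1 (node_rows c)).
Proof.
move=> sX.
have szc c : c \in catalog X -> size c = k.+1.
  by case/catalog_mem => x /sX sx -> /=; rewrite sx.
rewrite /catalog in szc *.
elim/last_ind: X sX szc => // X y IH sX szc x.
have sX' z : z \in X -> size z.1 = k.
  by move=> zX; apply: sX; rewrite mem_rcons inE zX orbT.
rewrite foldl_rcons in szc *; rewrite mem_rcons inE => /orP[/eqP ->|xX].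
  apply: record_sgneq => //.
  - exact: indexed_foldl.
  - by move=> c cin; apply/szc/record_sub.
  - by apply: sX; rewrite mem_rcons mem_head.
have [|c cin cs] := IH sX' _ x xX.
  by move=> c cin; apply/szc/record_sub.
by exists c => //; apply: record_sub.
Qed.

(** * One step of the classification *)

Definition admissible k (H : 'M[Z]_k) : Prop :=
  [/\ posdef H, forall i, H i i = 5%Z & odd_triangles H].

Lemma admissible_reindex k n (f : 'I_k -> 'I_n) b (H : 'M[Z]_n) :
  injective f -> admissible H -> admissible (signed_reindex f b H).
Proof.
move=> injf [pH dH oH]; split; [exact: posdef_signed_reindex | | exact: odd_triangles_reindex].
by move=> i; rewrite mxE -signr_addb addbb mul1r dH.
Qed.

Definition next_level (P : Z -> bool) (t : Z) (L : seq (seq cell)) : seq (seq cell) :=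
  catalog [seq x <- flatten [seq [seq (c, p) | p <- extensions t (node_det c) c] | c <- L]
          | P x.2.2].

(** Each list contains a representative of every admissible matrix with
    determinant at least t. The filter P is trivial except in the last step. *)
Definition complete_level k (P : Z -> bool) (t : Z) (L : seq (seq cell)) : Prop :=
  (forall c, c \in L -> size c = k /\ (node_pos c -> node_ok c)) /\
  forall H : 'M[Z]_k, admissible H -> t <= \det H -> P (\det H) ->
    exists2 c, c \in L & sgneq H (gram_mx k (node_rows c)).

Lemma grow_ok c t p : (node_pos c -> node_ok c) -> p \in extensions t (node_det c) c ->
  node_pos (grow (c, p)) -> node_ok (grow (c, p)).
Proof.
move=> okc pin pg; have pc := node_pos_tail pg; have {}okc := okc pc.
have [sv E] := extensions_sound okc pc pin; have [ss sE] := mul_adjE okc pc sv.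
by split; rewrite /= ?ss.
Qed.

Lemma mem_extensions P t L x :
  x \in [seq x <- flatten [seq [seq (c, p) | p <- extensions t (node_det c) c] | c <- L] | P x.2.2] ->
  x.1 \in L /\ x.2 \in extensions t (node_det x.1) x.1.
Proof.
by rewrite mem_filter => /andP[_ /flatten_mapP [c cL /mapP [p pin ->]]].
Qed.

Lemma ZpowE (a : Z) n : (a ^ Z.of_nat n)%Z = a ^+ n.
Proof. by lia. Qed.

(** By the condition on powers and big_principal, a matrix with determinant at
    least t' has a principal submatrix with determinant at least t. The latter
    is represented in L, and H is one of the enumerated borderings of the
    representative. *)
Lemma next_levelP k (P : Z -> bool) (t t' : Z) L : complete_level k xpredT t L -> 0 < t ->
  0 < t' -> ((t - 1) ^ Z.of_nat k.+1 <? t' ^ Z.of_nat k)%Z ->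
  complete_level k.+1 P t' (next_level P t' L).
Proof.
move=> [okL covL] t0 t0' tt'; split.
  move=> c /catalog_mem [[c' p] /mem_extensions /= [/okL [sc' okc'] pin] ->].
  by split; [rewrite /= sc' | exact: grow_ok okc' pin].
move=> H gH tH PH; have [pH dH oH] := gH.
have [i le_i] := big_principal pH.
have gG : admissible (principal H i) by rewrite principalE; apply: admissible_reindex => //; apply: lift_inj.
have tG : t <= \det (principal H i).
  rewrite leNgt; apply/negP => lt_t.
  have G0 : 0 < \det (principal H i) by case: gG => /posdef_det_gt0.
  have le1 : \det (principal H i) <= t - 1 by lia.
  have le2 : \det (principal H i) ^+ k.+1 <= (t - 1) ^+ k.+1.
    by rewrite lerXn2r // nnegrE ltW // (lt_le_trans G0).
  have le3 : t' ^+ k <= \det H ^+ k.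
    by rewrite lerXn2r // nnegrE ltW // (lt_le_trans t0').
  have := le_trans le3 (le_trans le_i le2).
  by rewrite leNgt => /negP; apply; rewrite !ZpowE in tt'.
have [c cL [f [b [injf KE]]]] := covL _ gG tG isT.
have [sc okc] := okL c cL; move: injf KE okc cL; case: k / sc H {gH} tH PH pH dH oH i le_i gG tG f b {covL tt'} okL.
move=> H tH PH pH dH oH i le_i gG tG f b okL injf KE okc cL.
have pc : node_pos c by rewrite /node_pos KE; apply: posdef_signed_reindex => //; case: gG.
have {}okc := okc pc.
pose w := [tuple (-1) ^+ b j * H i (lift i (f j)) | j < size c].
pose u : seq Z := w.
(* The sign that makes the entry with the oldest row nonnegative. *)
pose s := last 0%Z u < 0.
pose v := [seq (-1) ^+ s * z | z <- u].
have sv : size v = size c by rewrite size_map size_tuple.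
have lv : 0 <= last 0%Z v.
  have -> : last 0%Z v = (-1) ^+ s * last 0%Z u.
    by rewrite /v; case: (u) => [|z u'] /=; rewrite ?mulr0 // last_map.
  by rewrite /s; case: ltrP; rewrite ?mulN1r ?mul1r // oppr_ge0 => /ltW.
have HK : sgneq H (gram_mx (size c).+1 (v :: node_rows c)).
  have := @sgneq_border _ _ H i f b s _ (proj1 pH) injf KE.
  rewrite gram_mx_cons dH; congr (sgneq H (border _ _ _)).
  apply/rowP => j; rewrite !mxE (nth_map 0%Z) ?size_tuple //.
  by rewrite -(tnth_nth 0%Z w) tnth_mktuple mulrA.
have [f' [b' [injf' KE']]] := HK.
have detK : \det (gram_mx (size c).+1 (v :: node_rows c)) = \det H by rewrite KE' det_signed_reindex.
have pin : (v, \det H) \in extensions t' (node_det c) c.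
  rewrite -detK; apply: extensions_complete => //.
  - exact: ltW.
  - by rewrite node_detE // posdef_det_gt0.
  - by rewrite KE'; apply: posdef_signed_reindex.
  - by rewrite KE'; apply: odd_triangles_reindex.
  by rewrite mulrC detK ler_pM2l // node_detE // posdef_det_gt0.
pose X := [seq x <- flatten [seq [seq (c, p) | p <- extensions t' (node_det c) c] | c <- L] | P x.2.2].
have xX : (c, (v, \det H)) \in X.
  by rewrite mem_filter PH; apply/flatten_mapP; exists c => //; apply: map_f.
have sX x : x \in X -> size x.1 = size c.
  by case/mem_extensions => /okL [].
have [c' c'L HK'] := catalog_sgneq sX xX.
by exists c' => //; apply: sgneq_trans HK HK'.
Qed.

(** * Half Gram matrices of sign matrices *)

Section SignGram.
Variables (n : nat) (M : 'M[Z]_n).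

(** For order 10 this is M M^T / 2: the inner product of two sign vectors is
    10 minus twice the number of disagreements. *)
Definition half_gram : 'M[Z]_n :=
  \matrix_(i, j) (5%Z - \sum_l (M i l != M j l)%:R).

Hypothesis signM : forall i j, M i j = 1 \/ M i j = -1.

(** Among three signs, the number of unequal pairs is 0 or 2. *)
Lemma odd_triangles_half_gram : odd_triangles half_gram.
Proof.
move=> i j l; rewrite !mxE.
set S1 := \sum_l _; set S2 := \sum_l _; set S3 := \sum_l _.
pose c m : Z := ((M i m != M j m) || (M j m != M l m))%:R.
have E : S1 + S2 + S3 = \sum_m c m + \sum_m c m.
  rewrite -!big_split /=; apply: eq_bigr => m _; rewrite /c.
  by case: (signM i m) => ->; case: (signM j m) => ->; case: (signM l m) => ->.
have -> : (5%Z - S1) + (5%Z - S2) + (5%Z - S3) = 15%Z - (\sum_m c m + \sum_m c m).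
  by rewrite -E; lia.
by rewrite oddZD oddZN oddZD addbb.
Qed.

Hypothesis n10 : n%:R = 10%Z :> Z.

Lemma half_gramE : 2%Z *: half_gram = M *m M^T.
Proof.
apply/matrixP => i j; rewrite !mxE.
have -> : \sum_j0 M i j0 * M^T j0 j = \sum_l (1 - 2%Z * (M i l != M j l)%:R).
  apply: eq_bigr => l _; rewrite mxE.
  by case: (signM i l) => ->; case: (signM j l) => ->.
rewrite sumrB -mulr_sumr sumr_const card_ord n10 mulrBr.
by [].
Qed.

Lemma det_half_gram : (2%Z ^+ n) * \det half_gram = \det M ^+ 2.
Proof. by rewrite -detZ half_gramE det_mulmx det_tr expr2. Qed.

Lemma posdef_half_gram : \det M != 0 -> posdef half_gram.
Proof.
move=> dM; split=> [|x x0].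
  apply/matrixP => i j; rewrite !mxE; congr (_ - _); apply: eq_bigr => l _.
  by rewrite eq_sym.
suff : 0 < 2%Z * qform half_gram x by rewrite pmulr_rgt0.
have -> : 2%Z * qform half_gram x = \sum_j (x *m M) 0 j ^+ 2.
  have -> : 2%Z * qform half_gram x = (x *m (2%Z *: half_gram) *m x^T) 0 0.
    by rewrite -scalemxAr -scalemxAl mxE.
  rewrite half_gramE mulmxA -mulmxA -trmx_mul mxE.
  by apply: eq_bigr => j _; rewrite [_^T _ _]mxE expr2.
have [j yj] : exists j, (x *m M) 0 j != 0.
  apply/existsP; apply: contraR x0 => /existsPn y0.
  have y00 : x *m M = 0.
    by apply/rowP => j; rewrite [RHS]mxE; apply/eqP; have := y0 j; rewrite negbK.
  have /rowP := congr1 (mulmxr (\adj M)) y00.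
  rewrite /= -mulmxA mul_mx_adj mul_mx_scalar mul0mx => E.
  apply/eqP/rowP => j; have /eqP := E j; rewrite !mxE mulf_eq0 (negbTE dM) /=.
  by move/eqP.
rewrite (bigD1 j) //= ltr_wpDr // ?exprn_even_gt0 //.
by apply: sumr_ge0 => l _; apply: sqr_ge0.
Qed.

Lemma admissible_half_gram : \det M != 0 -> admissible half_gram.
Proof.
move=> dM; split; [exact: posdef_half_gram | | exact: odd_triangles_half_gram].
by move=> i; rewrite mxE big1 ?subr0 // => l _; rewrite eqxx.
Qed.

End SignGram.

(** * Obstruction modulo 3 *)

Definition mod3 : {rmorphism Z -> 'F_3} := intr \o int_of_Z.

Lemma mod3_eq0 z : mod3 z = 0 -> exists q, z = 3%Z * q.
Proof.
move=> z0; exists (z / 3)%Z.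
have zE : z = 3%Z * (z / 3)%Z + (z mod 3)%Z := Z_div_mod_eq_full z 3.
have := Z.mod_pos_bound z 3 erefl.
rewrite [LHS]zE; move: z0; rewrite {1}zE rmorphD rmorphM.
have -> : mod3 3%Z = 0 by apply: val_inj.
rewrite mul0r add0r; move: (z mod 3)%Z => r r0 [r1 r2].
have [->|[r3|r3]] : (r = 0 \/ r = 1 \/ r = 2)%Z by lia.
- by rewrite addr0.
- by move: r0; rewrite r3 => /(congr1 val).
- by move: r0; rewrite r3 => /(congr1 val).
Qed.

(** A kernel vector over the field with 3 elements is lifted to entries 0, 1
    and -1, which makes the candidates finite in number. *)
Lemma det_mod3_kernel n (M : 'M[Z]_n) q : \det M = 3%Z * q ->
  exists ys : n.-tuple Z, [/\ all (fun y => y \in [:: 0; 1; -1]%Z) ys,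
    ~~ all (fun y => y == 0%Z) ys & exists z, row_of n ys *m M = 3%Z *: z].
Proof.
move=> dM.
pose M3 := map_mx mod3 M.
have : \det M3 == 0.
  rewrite det_map_mx dM rmorphM (_ : mod3 3%Z = 0) ?mul0r //.
  exact: val_inj.
case/det0P => v v0 vM.
pose lift3 (a : 'F_3) : Z := if a == 0 then 0%Z else if a == 1 then 1%Z else (-1)%Z.
have lift3K a : mod3 (lift3 a) = a.
  by rewrite /lift3; case: a => [[|[|[|//]]] la] /=; apply: val_inj.
pose ys := [tuple lift3 (v 0 j) | j < n].
have ysE (j : 'I_n) : nth 0%Z ys j = lift3 (v 0 j) by rewrite -tnth_nth tnth_mktuple.
exists ys; split.
- apply/allP => y /mapP [j _ ->]; rewrite /lift3.
  by case: ifP => // _; case: ifP.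
- apply: contra v0 => /allP y0; apply/eqP/rowP => j; rewrite mxE -[LHS]lift3K.
  have /y0/eqP -> : lift3 (v 0 j) \in tval ys by rewrite -ysE mem_nth ?size_tuple.
  by [].
pose z := map_mx (fun a => (a / 3)%Z) (row_of n ys *m M); exists z.
apply/rowP => j; rewrite [RHS]mxE [z _ _]mxE.
have [|p ->] := @mod3_eq0 ((row_of n ys *m M) 0 j); last first.
  by congr (3%Z * _); rewrite mulrC; apply/esym/Z.div_mul.
have := congr1 (fun w : 'rV_n => w 0 j) vM; rewrite [RHS]mxE => <-.
have -> : v = map_mx mod3 (row_of n ys).
  by apply/rowP => l; rewrite !mxE ysE lift3K.
by rewrite /M3 -map_mxM [RHS]mxE.
Qed.

Definition trits := [:: 0; 1; -1]%Z.

(** To be used with acc = y H: a nonzero vector y that H kills modulo 3 must not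
    be isotropic modulo 9. *)
Definition anisotropic (ys acc : seq Z) : bool :=
  if all (fun a => a mod 3 =? 0)%Z acc then
    all (fun y => y == 0%Z) ys || ~~ (dot ys acc mod 9 =? 0)%Z
  else true.

(** Runs over all vectors with entries 0, 1 and -1; acc is the combination of
    the rows read so far, with coefficients ys in reverse order. *)
Fixpoint no_kernel (rs : seq (seq Z)) (acc ys : seq Z) : bool :=
  if rs is r :: rs' then
    all (fun y => no_kernel rs' (zip_with (fun a b => a + y * b)%Z acc r) (y :: ys)) trits
  else anisotropic (rev ys) acc.

Lemma no_kernelP rs acc ys zs k : no_kernel rs acc ys ->
  size acc = k -> all (fun r => size r == k) rs ->
  size zs = size rs -> all (fun z => z \in trits) zs ->
  exists2 s, anisotropic (rev ys ++ zs) s & size s = k /\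
    forall j, (j < k)%N -> nth 0%Z s j =
      nth 0%Z acc j + \sum_(i < size rs) nth 0%Z zs i * nth 0%Z (nth [::] rs i) j.
Proof.
elim: rs acc ys zs => [|r rs IH] acc ys [|z zs] //.
  move=> /= ani sa _ _ _; exists acc; rewrite ?cats0 //; split=> // j _.
  by rewrite big_ord0 addr0.
move=> nk sa; have {nk}/allP nk : all (fun y =>
  no_kernel rs (zip_with (fun a b => a + y * b)%Z acc r) (y :: ys)) trits := nk.
move=> /= /andP[/eqP sr srs] [sz] /andP[zt zst].
have sA : size (zip_with (fun a b => (a + z * b)%Z) acc r) = k.
  by rewrite size_zip_with ?sa ?sr.
have [s ani [ss sE]] := IH _ _ _ (nk z zt) sA srs sz zst.
exists s; first by rewrite rev_cons cat_rcons in ani.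
split=> // j jk; rewrite sE // nth_zip_with ?sa ?sr // big_ord_recl /= addrA.
by congr (_ + _).
Qed.

Definition cleared (n : nat) (c : seq cell) : bool :=
  let F := gram_rows (node_rows c) in
  [&& all (fun r => size r == n) F, (node_det c mod 3 =? 0)%Z &
      no_kernel F (nseq n 0%Z) [::]].

(** Suppose 2 H = M M^T. If 3 divides \det H, it divides \det M, so some y that
    is nonzero modulo 3 satisfies y M = 3 z. Then 2 y H = 3 z M^T and
    2 y H y^T = 9 z z^T, so y is killed by H modulo 3 and isotropic modulo 9. *)
Lemma cleared_no_gram n c (M : 'M[Z]_n) : size c = n -> node_ok c ->
  2%Z *: gram_mx n (node_rows c) = M *m M^T -> ~~ cleared n c.
Proof.
move=> sc okc EM; apply/negP => /and3P[sF /eqP d3 nk].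
have dM : 2%Z ^+ n * node_det c = \det M * \det M.
  rewrite node_detE // -{2}(det_tr M) -det_mulmx -EM detZ.
  by move: EM d3 sF nk; case: n / sc M.
have [q dq] : exists q, \det M = 3%Z * q.
  apply: mod3_eq0; apply/eqP; rewrite -[_ == 0]orbb -mulf_eq0 -rmorphM -dM.
  have -> : node_det c = 3%Z * (node_det c / 3)%Z.
    by have := Z_div_mod_eq_full (node_det c) 3; rewrite d3 Z.add_0_r.
  by rewrite !rmorphM (_ : mod3 3%Z = 0) ?mul0r ?mulr0 //; apply: val_inj.
have [ys [yt y0 [z yM]]] := det_mod3_kernel dq.
set H := gram_mx n (node_rows c) in EM.
have sFn : size (gram_rows (node_rows c)) = n by rewrite size_gram_rows size_map.
have [||s] := no_kernelP nk _ sF _ yt; rewrite ?size_nseq ?size_tuple //=.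
rewrite /anisotropic => ani [ss sE].
have rs : row_of n s = row_of n ys *m H.
  apply/rowP => j; rewrite !mxE sE ?nth_nseq ?ltn_ord // add0r sFn.
  by apply: eq_bigr => i _; rewrite !mxE nth_gram_rows // size_map sc.
have E1 : 2%Z *: row_of n s = 3%Z *: (z *m M^T).
  by rewrite rs scalemxAr EM mulmxA yM scalemxAl.
have E2 : 2%Z * dot ys s = 9%Z * (z *m z^T) 0 0.
  rewrite -(@dotE n) ?size_tuple //.
  have : 2%Z *: (row_of n ys *m (row_of n s)^T) = 9%Z *: (z *m z^T).
    rewrite scalemxAr -linearZ /= E1 linearZ /= trmx_mul trmxK -scalemxAr mulmxA.
    by rewrite yM -scalemxAl scalerA.
  by move/(congr1 (fun w : 'M_1 => w 0 0)); rewrite [LHS]mxE [RHS]mxE.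
move: ani; rewrite ifT; last first.
  apply/(all_nthP 0%Z) => j; rewrite ss => jn.
  have := congr1 (fun w : 'rV_n => w 0 (Ordinal jn)) E1.
  rewrite [LHS]mxE [RHS]mxE [row_of _ _ _ _]mxE /=; move: (nth _ _ _) (_ 0 _) => p r E.
  apply/Z.eqb_eq; have -> : p = ((p - r) * 3)%Z by move: E; lia.
  exact: Z.mod_mul.
rewrite (negbTE y0) /=; move/negP; apply.
move: (dot _ _) (_ 0 0) E2 => p r E.
apply/Z.eqb_eq; have -> : p = ((p - 4 * r) * 9)%Z by move: E; lia.
exact: Z.mod_mul.
Qed.

(** * Sign matrices of order 10 with large determinant *)

Lemma node_pos_of_size n c : size c = n -> posdef (gram_mx n (node_rows c)) -> node_pos c.
Proof. by move=> <-. Qed.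

Definition large_dets := [:: 104; 105; 108; 110; 112; 116; 117; 120; 125; 128; 144]%Z.

(** Recognizes 256 d^2 with d outside large_dets. Testing the last eight bits
    first spares most square roots. *)
Definition missing_det (E : Z) : bool :=
  if (Z.land E 255 =? 0)%Z then
    let d := Z.sqrt (E / 256) in
    (256 * (d * d) =? E)%Z && ~~ has (Z.eqb d) large_dets
  else false.

(** The threshold for order k is (256 * 103 ^ 2) ^ (k / 10), rounded up; the
    first ones are 5, 20 and 86. *)
Definition final_level : seq (seq cell) :=
  next_level missing_det 2715904 (next_level xpredT 617338 (next_level xpredT 140324
    (next_level xpredT 31897 (next_level xpredT 7251 (next_level xpredT 1648 (next_level xpredT 375
      (next_level xpredT 86 (next_level xpredT 20 (next_level xpredT 5 [:: [::]]))))))))).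

Lemma final_level_cleared : all (cleared 10) final_level.
Proof. vm_cast_no_check (erefl true). Qed.

Lemma complete_level0 : complete_level 0 xpredT 1 [:: [::]].
Proof.
split=> [c|H _ _ _]; first by rewrite inE => /eqP ->.
exists [::]; rewrite ?mem_head //.
have -> : gram_mx 0 (node_rows [::]) = H by apply/matrixP => -[].
exact: sgneq_refl.
Qed.

Lemma complete_final_level : complete_level 10 missing_det 2715904 final_level.
Proof.
have c1 := @next_levelP 0 xpredT 1 5 _ complete_level0 erefl erefl erefl.
have c2 := @next_levelP 1 xpredT 5 20 _ c1 erefl erefl erefl.
have c3 := @next_levelP 2 xpredT 20 86 _ c2 erefl erefl erefl.
have c4 := @next_levelP 3 xpredT 86 375 _ c3 erefl erefl erefl.
have c5 := @next_levelP 4 xpredT 375 1648 _ c4 erefl erefl erefl.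
have c6 := @next_levelP 5 xpredT 1648 7251 _ c5 erefl erefl erefl.
have c7 := @next_levelP 6 xpredT 7251 31897 _ c6 erefl erefl erefl.
have c8 := @next_levelP 7 xpredT 31897 140324 _ c7 erefl erefl erefl.
have c9 := @next_levelP 8 xpredT 140324 617338 _ c8 erefl erefl erefl.
exact (@next_levelP 9 missing_det 617338 2715904 _ c9 erefl erefl erefl).
Qed.

Lemma missing_det_sqr d : 0 <= d -> d \notin large_dets -> missing_det (256%Z * (d * d)).
Proof.
move=> d0 dL; rewrite /missing_det.
have -> : (Z.land (256%Z * (d * d))%R 255 = 0)%Z.
  rewrite (Z.land_ones _ 8) // mulrC; exact: Z.mod_mul.
have -> : ((256%Z * (d * d))%R / 256 = d * d)%Z.
  rewrite mulrC; exact: Z.div_mul.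
have -> : Z.sqrt (d * d) = d by apply: Z.sqrt_square; lia.
rewrite !Z.eqb_refl; apply/negP => /hasP [x xL /Z.eqb_eq dx].
by rewrite dx xL in dL.
Qed.

(* Conversion must not run the enumeration again. *)
Opaque final_level.

Lemma sign_det_large (M : 'M[Z]_10) (d : Z) :
  (forall i j, M i j = 1 \/ M i j = -1) ->
  \det M ^+ 2 = 2%Z ^+ 18 * (d * d) -> 103%Z <= d -> d \in large_dets.
Proof.
move=> signM dM d103; apply/negPn/negP => dL.
have dM0 : \det M != 0.
  apply/eqP => d0; move: dM; rewrite d0 expr0n /=; nia.
have gH := admissible_half_gram signM erefl dM0.
have dH : \det (half_gram M) = 256%Z * (d * d).
  have := det_half_gram signM erefl; rewrite dM.
  have -> : 2%Z ^+ 10 = 1024%Z :> Z by [].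
  have -> : 2%Z ^+ 18 = 262144%Z :> Z by [].
  lia.
have [||c cS] := complete_final_level.2 _ gH.
- rewrite dH; nia.
- by rewrite dH; apply: missing_det_sqr => //; lia.
move=> [f [b [injf KE]]].
have [sc okc] := complete_final_level.1 _ cS.
have {}okc : node_ok c.
  have [pH _ _] := gH; apply: okc; apply: (node_pos_of_size sc).
  by rewrite KE; exact (posdef_signed_reindex b injf pH).
have clr := allP final_level_cleared _ cS.
have E : 2%Z *: half_gram M = M *m M^T := half_gramE signM erefl.
have E' : 2%Z *: gram_mx 10 (node_rows c) = (signed_incl _ f b *m M) *m (signed_incl _ f b *m M)^T.
  rewrite KE signed_reindexE scalemxAl scalemxAr E trmx_mul !mulmxA. by [].
exact (negP (cleared_no_gram sc okc E') clr).
Qed.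

(** * Attained determinants *)

Fixpoint del (j : nat) (s : seq bool) {struct s} : seq bool :=
  match s, j with
  | [::], _ => [::]
  | _ :: s', 0 => s'
  | x :: s', j'.+1 => x :: del j' s'
  end.

Lemma nth_del j s k : nth false (del j s) k = nth false s (bump j k).
Proof.
elim: s j k => [|x s IH] [|j] [|k] //=; rewrite ?nth_nil //.
by rewrite IH /bump ltnS; case: (j <= k)%N.
Qed.

Fixpoint laplace (n : nat) (rs : seq (seq bool)) : Z :=
  if n is n'.+1 then
    foldr (fun j acc =>
      if nth false (head [::] rs) j then
        let m := laplace n' (map (del j) (behead rs)) in
        ((if odd j then - m else m) + acc)%Z
      else acc) 0%Z (iota 0 n)
  else 1%Z.

Definition bitmx n (rs : seq (seq bool)) : 'M[Z]_n :=
  \matrix_(i, j) (nth false (nth [::] rs i) j)%:R.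

Lemma row_col_bitmx n rs (j : 'I_n.+1) :
  row' ord0 (col' j (bitmx n.+1 rs)) = bitmx n (map (del j) (behead rs)).
Proof.
have nth_map_del i : nth [::] (map (del j) (behead rs)) i = del j (nth [::] rs i.+1).
  rewrite -nth_behead; case: (ltnP i (size (behead rs))) => [li|ge].
    by rewrite (nth_map [::]).
  by rewrite (nth_default _ ge) nth_default ?size_map.
by apply/matrixP => a b; rewrite !mxE nth_map_del nth_del.
Qed.

Lemma det_bitmx n rs : \det (bitmx n rs) = laplace n rs.
Proof.
elim: n rs => [|n IH] rs; first by rewrite det_mx00.
rewrite (expand_det_row _ ord0).
pose F j := if nth false (head [::] rs) j then
  (-1) ^+ odd j * laplace n (map (del j) (behead rs)) else 0.
have step (j : 'I_n.+1) : bitmx n.+1 rs ord0 j * cofactor (bitmx n.+1 rs) ord0 j = F j.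
  rewrite mxE /F nth0; case: (nth false _ j); rewrite ?mul0r // mul1r /cofactor.
  by rewrite row_col_bitmx IH signr_odd.
rewrite (eq_bigr _ (fun j _ => step j)) -(big_mkord xpredT F) unlock /index_iota subn0.
rewrite [RHS]/laplace -/laplace.
elim: (iota _ _) => //= j s ->; rewrite /applybig /= /F.
by case: (nth false _ j); rewrite ?add0r //; case: (odd j); rewrite ?mulN1r ?mul1r.
Qed.

Definition decode (w : Z) : seq (seq bool) :=
  [seq [seq Z.testbit w (Z.of_nat (9 * i + j)) | j <- iota 0 9] | i <- iota 0 9].

(** One matrix for each element of spectrum9, written as a number whose bits are
    the entries. The matrices are sparse, to keep the expansions short. *)
Definition witnesses : seq Z := [::
  856090654918942897735680; 1668858868155374256522496;
  1668858868173159279887616; 1409409813162844633438272;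
  1908879555506763416503314; 1529475398223401045794824;
  2201917019289164724570880; 534270166693572191211586;
  591094105485787119288864; 1974438380685529923584524;
  1349584642621169929359424; 1974438380700602254526476;
  591094105485787119288866; 779461719378471858868296;
  2231038331152210456625186; 839626196185366615687698;
  1042211787408169328714370; 1006971666037465596723203;
  698330955328192015240272; 567475207919249059905539;
  1042211787408161581850641; 1006971666015337943564291;
  568645207073608870274051; 695759092304092938113616;
  1006976739753119785226243; 924626269663787907816481;
  1607031394677986989015049; 698332413110894276643920;
  852113226245662853971980; 698332235814163261426768;
  1319202933516713252258881; 1271954366909280438863912;
  1342204840483982414058625; 1842139511682188680725064;
  1673522226682931801890976; 490835924996704923949128;
  672213820096177443588136; 1314701625988267316628256;
  1743533891456468535773568; 923896909965525401667744;
  1673522221099252955749536; 1631709848966128653516805;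
  1831214219380297854666016; 923899774480170181396640;
  1083978208930431246991440; 1896808974284201222866052;
  888912998773086178918921; 218933212559888482353956;
  1314701625988263290096416; 1900856027447768620646568;
  1020730020625174508963873; 490835924996704923857164;
  357816486569545119646404; 817663251464606563074594; 953476939557369527223364;
  749209109897980341060646; 1020730020625133200574784;
  1486108380327344432263344; 1314701617870036232063776;
  959136316030267806550368; 1020730012659034018384145;
  1938883854700376134297760; 923899774480170181396648;
  1867416218018681894217286; 1493187950475908928381768;
  923899782537831375898792; 1020727904974408467956420;
  998979023894801359594820; 2012423451205692145316001;
  1484434358966235773055152; 1467790264461647161643273;
  962303031115452625553760; 2044216954808511398962264;
  1937156026889024782796452; 1486108384489454405202096;
  1904198759832402148395288; 1020730020625174508946116;
  1411551283585278289986100; 1920390916389111713325082;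
  1340877417224293890560137; 1034698365498765906969861;
  523676940163139278570648; 554511786559609541167384;
  1904196729822176603736344; 1314704264211553199621669;
  824192971086056962330817; 2163669855602689950441554;
  880393370789925958126636; 2013721728127865475586209;
  1848599835840402479583554; 291177643443565814679216;
  1459946382161658768275730; 822426909917129466722578;
  1917849492200933554718384; 1460817545759404539787538;
  823791348032278366888040; 1993636717147526073967208;
  1495343132618938993461648; 556439401834763099216096;
  2024472724962844419146793; 1103445468261578633025578;
  882007533979591264738329; 1904196729841618619122702;
  1086989485279855047549065; 1321896510643957902403657;
  1692704038028699238443670; 2140667181456377459724326;
  1086984728253377517920393; 224189795437307411707025;
  1906782075445912430597345; 225286755966671540335761;
  1495343132641734231968145; 976866889710818625406820; 1620902654803725028511200]%Z.

Definition spectrum9 : seq nat :=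
  iota 0 103 ++ [:: 104; 105; 108; 110; 112; 116; 117; 120; 125; 128; 144]%N.

Lemma witnessesP : all2 (fun d w => Z.abs (laplace 9 (decode w)) =? Z.of_nat d)%Z
  spectrum9 witnesses.
Proof. vm_cast_no_check (erefl true). Qed.

Lemma all2_exists (S T : eqType) (p : S -> T -> bool) s t x :
  all2 p s t -> x \in s -> exists y, p x y.
Proof.
elim: s t => [|x' s IH] [|y t] //= /andP[pxy /IH {}IH].
by rewrite inE => /orP[/eqP ->|/IH //]; exists y.
Qed.

Lemma mem_spectrum9 d : d \in spectrum9 -> det_spectrum 9 d.
Proof.
move=> /(all2_exists witnessesP) [w /Z.eqb_eq]; move: (decode w) => rs dE.
exists (\matrix_(i, j) (nth false (nth [::] rs i) j)%:R).
  by move=> i j; rewrite mxE; case: nth; [right | left].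
set A := \matrix_(i, j) _.
have E : Z_of_int (\det A) = laplace 9 rs.
  rewrite -det_bitmx -det_map_mx; congr (\det _).
  by apply/matrixP => i j; rewrite !mxE rmorph_nat.
lia.
Qed.

(** * The spectrum *)

(** Adding multiples of the border of ones removes the constant part of the
    block. *)
Lemma sign_border n (B : 'M[Z]_n) :
  \det (block_mx (1%:M : 'M_1) (const_mx 1) (const_mx 1) (const_mx 1 - 2%Z *: B)) =
  (-2%Z) ^+ n * \det B.
Proof.
rewrite (_ : block_mx _ _ _ _ = block_mx (1%:M : 'M_1) 0 (const_mx 1) 1%:M *m
    block_mx (1%:M : 'M_1) (const_mx 1) 0 (- 2%Z *: B)).
  by rewrite det_mulmx det_lblock det_ublock !det1 !mul1r detZ.
rewrite mulmx_block !mulmx1 !mul1mx !mulmx0 !mul0mx !addr0 scaleNr; congr (block_mx _ _ _ (_ - _)).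
by apply/matrixP => i j; rewrite !mxE big_ord1 !mxE mulr1.
Qed.

Lemma det_spectrum9_sub d : det_spectrum 9 d -> d \in spectrum9.
Proof.
case=> A A01 dE.
pose B := map_mx Z_of_int A.
pose M : 'M[Z]_(1 + 9) :=
  block_mx (1%:M : 'M_1) (const_mx 1) (const_mx 1) (const_mx 1 - 2%Z *: B).
have signM i j : M i j = 1 \/ M i j = -1.
  rewrite /M; case: (split_ordP i) => i' ->; case: (split_ordP j) => j' ->.
  - by rewrite block_mxEul mxE !ord1; left.
  - by rewrite block_mxEur mxE; left.
  - by rewrite block_mxEdl mxE; left.
  by rewrite block_mxEdr !mxE; case: (A01 i' j') => ->; [left | right].
rewrite mem_cat; have [d102|d103] := leqP d 102; first by rewrite mem_iota add0n ltnS d102.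
have dM : \det M ^+ 2 = 2%Z ^+ 18 * (Z.of_nat d * Z.of_nat d).
  have dB : \det B = Z_of_int (\det A) by rewrite det_map_mx.
  have d2 : \det B * \det B = Z.of_nat d * Z.of_nat d.
    rewrite dB -dE; lia.
  by rewrite sign_border exprMn [\det B ^+ 2]expr2 d2; congr (_ * _).
have := sign_det_large signM dM.
have -> : large_dets = [seq Z.of_nat k | k <- [:: 104; 105; 108; 110; 112; 116; 117; 120; 125; 128; 144]%N] by [].
rewrite mem_map; last by move=> ? ?; apply: Nat2Z.inj.
move=> -> //; rewrite ?orbT //; lia.
Qed.

Local Open Scope classical_set_scope.

Theorem mainTheorem2 :
  det_spectrum 9 =
    [set d : nat | (d <= 102)%N] `|`
    [set d : nat | d \in [:: 104; 105; 108; 110; 112; 116; 117; 120;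
                             125; 128; 144]%N]
  /\ least_missing_det 9 = 103%N.
Proof.
have specE d : det_spectrum 9 d <-> d \in spectrum9.
  by split; [exact: det_spectrum9_sub | exact: mem_spectrum9].
split.
  apply/seteqP; split=> d /=; rewrite specE mem_cat mem_iota /= add0n ltnS.
    by case/orP; [left | right].
  by case=> ->; rewrite ?orbT.
rewrite /least_missing_det; case: ex_minnP => m /andP[m0 /asboolP mS] mmin.
have m103 : (m <= 103)%N.
  by apply: mmin; apply/asboolP; rewrite specE.
apply/eqP; rewrite eqn_leq m103 leqNgt; apply/negP => lt103; apply: mS.
by rewrite specE mem_cat mem_iota lt103.
Qed.
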